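(* Let $k \geq 1$ be an integer and let $n$ be an integer with $n > 2k$. If $n$ is odd, then $$m(n) \leq \binom{n+k-1}{k}\, m(n-2k) + \binom{n+k-1}{k-1}\, 2^{n-1}.$$ If $n$ is even, then $$m(n) \leq \binom{n+k-1}{k}\, m(n-2k) + \binom{n+k-1}{k-1}\left(2^{n-1} + \frac{1}{2}\binom{n}{n/2}\right).$$
   Context: A hypergraph $H=(V,E)$ consists of a finite vertex set $V$ and a set $E$ of subsets of $V$ (hyperedges); it is $n$-uniform if every hyperedge has exactly $n$ vertices. A 2-coloring of $H$ assigns one of two colors (red, blue) to each vertex; it is proper if no hyperedge is monochromatic. $H$ is non-2-colorable if it has no proper 2-coloring. For an integer $n \geq 1$, $m(n)$ denotes the minimum number of hyperedges in a non-2-colorable $n$-uniform hypergraph. *)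

(* Defs.v *)
From mathcomp Require Import all_boot all_order all_algebra.
From mathcomp Require Import boolp.
Set Implicit Arguments.
Unset Strict Implicit.
Unset Printing Implicit Defensive.

Record hypergraph := Hypergraph {
  vertex : finType;
  hyperedges : {set {set vertex}}
}.

Definition uniform (n : nat) (H : hypergraph) : Prop :=
  forall e, e \in hyperedges H -> #|e| = n.

(* The two colors are the two booleans. An empty hyperedge counts as
   monochromatic; this only matters for 0-uniform hypergraphs. *)
Definition monochromatic (V : finType) (c : V -> bool) (e : {set V}) : Prop :=
  exists b : bool, forall v, v \in e -> c v = b.

Definition proper_coloring (H : hypergraph) (c : vertex H -> bool) : Prop :=
  forall e, e \in hyperedges H -> ~ monochromatic c e.

Definition two_colorable (H : hypergraph) : Prop :=
  exists c : vertex H -> bool, proper_coloring c.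

Definition non_two_colorable_size (n q : nat) : Prop :=
  exists H : hypergraph,
    [/\ uniform n H, ~ two_colorable H & #|hyperedges H| = q].

(* Witness: all n-subsets of a set of 2n vertices. *)
Lemma non_two_colorable_size_ex (n : nat) :
  exists q, `[< non_two_colorable_size n q >].
Proof.
pose H := @Hypergraph 'I_(n + n) [set e : {set 'I_(n + n)} | #|e| == n].
exists #|hyperedges H|; apply/asboolP; exists H; split=> //.
  by move=> e; rewrite inE => /eqP.
case=> c cP.
have [b le_nb] : exists b, n <= #|[set v | c v == b]|.
  have cardAB : #|[set v | c v == true]| + #|[set v | c v == false]| = n + n.
    rewrite -[RHS](card_ord (n + n)) -(cardsC [set v | c v == true]).
    by congr (_ + _); apply: eq_card => v; rewrite !inE eqb_id eqbF_neg.
  case: (leqP n #|[set v | c v == true]|) => [|lt_n]; first by exists true.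
  exists false; rewrite -(leq_add2l n) -cardAB leq_add2r.
  exact: ltnW.
set A := [set v | c v == b] in le_nb.
have := cP [set v in take n (enum A)].
rewrite inE cardsE (card_uniqP (take_uniq _ (enum_uniq _))).
rewrite size_takel -?cardE // eqxx => /(_ isT); apply; exists b => v.
by rewrite inE => /mem_take; rewrite mem_enum inE => /eqP.
Qed.

Definition m (n : nat) : nat := ex_minn (non_two_colorable_size_ex n).

(* Main.v *)
(** Let [H'] be an optimal (n-2k)-uniform hypergraph and add [n+k-1] disjoint
    pairs of new vertices.  The edges are the edges of [H'] completed by [k] full
    pairs, together with the transversals of [n] pairs that pick the first
    vertex in a set [K] of pairs, where the size of [K] is subject to a condition [P].
    In any coloring [H'] has a monochromatic edge, say red.  Either [k] pairs
    are red, or [n] pairs each contain a blue vertex.  In the latter case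
    there is a blue transversal of these [n] pairs; if one of the pairs is blue,
    then there are two of them, whose sets [K] have consecutive sizes, and
    otherwise the complementary transversal is red.  So it is enough that [P]
    holds for one of [j], [j+1] and for one of [j], [n-j].  For odd [n] take the
    odd sizes; for even [n] take the odd sizes below [n/2], the even sizes
    above [n/2] and [n/2] itself. *)
Require Import Defs.
From mathcomp Require Import all_boot all_order all_algebra.
From mathcomp Require Import boolp zify lra.
Set Implicit Arguments.
Unset Strict Implicit.
Unset Printing Implicit Defensive.
Import GRing.Theory Num.Theory.

Lemma m_spec (n : nat) : non_two_colorable_size n (m n).
Proof. by rewrite /m; case: ex_minnP => q /asboolP. Qed.

Lemma m_min (n q : nat) : non_two_colorable_size n q -> m n <= q.
Proof. by move=> nq; rewrite /m; case: ex_minnP => r _; apply; apply/asboolP. Qed.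

Lemma exists_subset_card (T : finType) (A : {set T}) (j : nat) :
  j <= #|A| -> exists2 B : {set T}, B \subset A & #|B| = j.
Proof.
rewrite -bin_gt0 -cards_draws card_gt0 => /set0Pn[B].
by rewrite inE => /andP[BA /eqP]; exists B.
Qed.

Lemma card_draws_pred (T : finType) (A : {set T}) (P : pred nat) :
  #|[set B : {set T} | (B \subset A) && P #|B|]|
    = \sum_(j < #|A|.+1 | P j) 'C(#|A|, j).
Proof.
rewrite -sum1_card.
(* Group the subsets by size; [inord] returns the true size because [#|B| <= #|A|]. *)
rewrite (partition_big (fun B : {set T} => inord #|B| : 'I_#|A|.+1) P) /=; last first.
  move=> B; rewrite inE => /andP[BA PB].
  by rewrite inordK // ltnS subset_leq_card.
apply: eq_bigr => j Pj; rewrite -cards_draws -[RHS]sum1_card.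
apply: eq_bigl => B; rewrite !inE -andbA; apply: andb_id2l => BA.
rewrite -val_eqE /= inordK ?ltnS ?subset_leq_card //.
by apply/andP/eqP => [[_ /eqP]|->].
Qed.

Lemma card_setX_dep (S T : finType) (p : pred S) (q : S -> pred T) (r : nat) :
  (forall x, p x -> #|[set y | q x y]| = r) ->
  #|[set z : S * T | p z.1 && q z.1 z.2]| = #|[set x | p x]| * r.
Proof.
move=> qr; rewrite -sum1_card -sum_nat_const.
under eq_bigl do rewrite inE.
rewrite -(pair_big_dep p q (fun _ _ => 1)) /=.
under [RHS]eq_bigl do rewrite inE.
by apply: eq_bigr => x px; rewrite -(qr x px) -sum1_card; apply: eq_bigl => y; rewrite inE.
Qed.

Section Construction.
Variables (V I : finType).
Implicit Types (e : {set V}) (S K : {set I}) (c : V + I * bool -> bool).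

Definition join_pairs e S : {set V + I * bool} :=
  [set v | match v with inl x => x \in e | inr z => z.1 \in S end].

(** Pair [i] consists of [inr (i, true)], its first vertex, and [inr (i, false)], so the truth value
    of [i \in K] is itself the choice. *)
Definition transversal S K : {set V + I * bool} :=
  [set inr (i, i \in K) | i in S].

Lemma card_join_pairs e S : #|join_pairs e S| = #|e| + 2 * #|S|.
Proof.
have -> : join_pairs e S = (inl @: e) :|: (inr @: setX S [set: bool]).
  apply/setP => -[x|[i b]]; rewrite !inE /=.
    rewrite (mem_imset _ _ inl_inj); apply/idP/orP => [|[//|/imsetP[]//]].
    by left.
  rewrite (mem_imset _ _ inr_inj) !inE andbT.
  by apply/idP/orP => [|[/imsetP[]//|//]]; right.
rewrite cardsU !card_imset ?cardsX ?cardsT ?card_bool; [|exact: inr_inj|exact: inl_inj].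
rewrite [_ :&: _](_ : _ = set0) ?cards0; first lia.
apply/setP => v; rewrite !inE; apply/negP => /andP[/imsetP[x _ ->]].
by case/imsetP.
Qed.

Lemma card_transversal S K : #|transversal S K| = #|S|.
Proof. by rewrite card_imset // => i j []. Qed.

Lemma join_pairs_monochromatic c e S b :
  (forall x, x \in e -> c (inl x) = b) ->
  (forall i x, i \in S -> c (inr (i, x)) = b) ->
  monochromatic c (join_pairs e S).
Proof. by move=> ce cS; exists b => -[x|[i x]]; rewrite inE => /=; auto. Qed.

Lemma transversal_monochromatic c S K b :
  (forall i, i \in S -> c (inr (i, i \in K)) = b) ->
  monochromatic c (transversal S K).
Proof. by move=> cS; exists b => v /imsetP[i iS ->]; apply: cS. Qed.

Lemma exists_monochromatic_transversal (P : pred nat) c S b :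
  (forall j, P j || P j.+1) ->
  (forall j, j <= #|S| -> P j || P (#|S| - j)) ->
  (forall i, i \in S -> exists x, c (inr (i, x)) = b) ->
  exists K, [/\ K \subset S, P #|K| & monochromatic c (transversal S K)].
Proof.
move=> Psucc Pcompl cS.
pose K := [set i in S | c (inr (i, true)) == b].
have KS : K \subset S by apply/subsetP => i; rewrite inE => /andP[].
have cK i : i \in S -> c (inr (i, i \in K)) = b.
  move=> iS; rewrite inE iS /=; case: eqP => // ncb.
  by have [[]] := cS i iS.
case PK: (P #|K|).
  by exists K; split=> //; apply: (@transversal_monochromatic _ _ _ b).
have [i /and3P[iS /eqP cit /eqP cif]|noboth] :=
  pickP (fun i => [&& i \in S, c (inr (i, true)) == b & c (inr (i, false)) == b]).
  (* Both vertices of pair [i] have color [b], so switching the choice at [i] keeps the color and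
     lowers the size of [K] by one. *)
  have iK : i \in K by rewrite inE iS cit eqxx.
  exists (K :\ i); split; first by apply: subset_trans KS; apply: subD1set.
    by have := Psucc #|K :\ i|; have := cardsD1 i K; rewrite iK add1n => <-; rewrite PK orbF.
  apply: (@transversal_monochromatic _ _ _ b) => j jS.
  by rewrite !inE jS; case: eqVneq => [->//|_] /=; have := cK j jS; rewrite inE jS.
(* Now each pair of [S] has exactly one vertex of color [b]; the complementary choice has color
   [~~ b] throughout. *)
exists (S :\: K); split; first exact: subsetDl.
  have := Pcompl _ (subset_leq_card KS); rewrite PK /=.
  by rewrite cardsD (setIidPr KS).
apply: (@transversal_monochromatic _ _ _ (~~ b)) => i iS.
have neqb (x : bool) : x != b -> x = ~~ b by case: x; case: (b).
have := noboth i; rewrite !inE iS /= andbT.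
by case: eqVneq => [_ /= /negbT|ncit _]; apply: neqb.
Qed.

End Construction.

Lemma m_le_of_pred (k n : nat) (P : pred nat) :
  1 <= k -> 2 * k < n ->
  (forall j, P j || P j.+1) ->
  (forall j, j <= n -> P j || P (n - j)) ->
  m n <= 'C(n + k - 1, k) * m (n - 2 * k)
         + 'C(n + k - 1, k - 1) * \sum_(j < n.+1 | P j) 'C(n, j).
Proof.
move=> k_gt0 lt_2kn Psucc Pcompl.
have [[V E] [/= Eunif Enot2 Ecard]] := m_spec (n - 2 * k).
(* With this many pairs, if fewer than [k] are entirely of color [b], at least [n] pairs contain the
   other color. *)
set N := n + k - 1.
pose E1 := [set @join_pairs V 'I_N z.1 z.2
           | z in setX E [set S : {set 'I_N} | #|S| == k]].
pose D := [set z : {set 'I_N} * {set 'I_N}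
          | (#|z.1| == n) && ((z.2 \subset z.1) && P #|z.2|)].
pose E2 := [set transversal V z.1 z.2 | z in D].
have card_draws_ord j : #|[set S : {set 'I_N} | #|S| == j]| = 'C(N, j).
  by rewrite card_draws card_ord.
apply: leq_trans (_ : #|E1 :|: E2| <= _); last first.
  apply: leq_trans (leq_card_setU _ _) _; apply: leq_add.
    apply: leq_trans (leq_imset_card _ _) _.
    by rewrite cardsX card_draws_ord Ecard mulnC.
  have CN : 'C(N, k - 1) = 'C(N, n).
    by rewrite (_ : k - 1 = N - n) ?bin_sub //; rewrite /N; lia.
  apply: leq_trans (leq_imset_card _ _) _.
  have -> // : #|D| = 'C(N, k - 1) * \sum_(j < n.+1 | P j) 'C(n, j).
  rewrite CN -card_draws_ord.
  apply: (card_setX_dep (q := fun S K : {set 'I_N} => (K \subset S) && P #|K|)).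
  by move=> S /eqP Sn; rewrite card_draws_pred Sn.
apply: m_min; exists (@Hypergraph (V + 'I_N * bool)%type (E1 :|: E2)); split=> //=.
  move=> e; rewrite inE => /orP[/imsetP[z]|/imsetP[z]].
    rewrite !inE => /andP[zE /eqP zk] ->.
    by rewrite card_join_pairs (Eunif _ zE) zk subnK // ltnW.
  by rewrite inE => /andP[/eqP zn _] ->; rewrite card_transversal.
case=> c /= c_proper; apply: Enot2; exists (fun x => c (inl x)) => e eE [b ceb].
(* The pairs that can complete [e] to an edge entirely of color [b]. *)
pose A := [set i : 'I_N | [forall x, c (inr (i, x)) == b]].
have [le_kA|lt_Ak] := leqP k #|A|.
  have [S SA Sk] := exists_subset_card le_kA.
  apply: (c_proper (join_pairs e S)).
    rewrite inE; apply/orP; left; apply/imsetP; exists (e, S) => //.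
    by rewrite !inE eE Sk eqxx.
  apply: (@join_pairs_monochromatic _ _ _ _ _ b) => // i x iS.
  by have := subsetP SA i iS; rewrite inE => /forallP/(_ x)/eqP.
have le_nA : n <= #|~: A| by have := cardsC A; rewrite card_ord /N; move: #|A| #|~: A| lt_Ak; lia.
have [S SA Sn] := exists_subset_card le_nA.
have [|i iS|K [KS PK]] := @exists_monochromatic_transversal _ _ P c S (~~ b) Psucc.
- by rewrite Sn.
- have := subsetP SA i iS; rewrite !inE negb_forall => /existsP[x cx].
  by exists x; case: (c _) b cx {ceb A le_nA lt_Ak SA} => [] [].
apply: c_proper; rewrite inE; apply/orP; right; apply/imsetP; exists (S, K) => //.
by rewrite inE Sn eqxx KS.
Qed.

(** Add the sum to its reflection under [j -> n - j]: each [j] is counted at least once, and twice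
    exactly when both [P j] and [P (n - j)] hold. *)
Lemma sum_bin_pred_double (n : nat) (P : pred nat) :
  (forall j, j <= n -> P j || P (n - j)) ->
  2 * (\sum_(j < n.+1 | P j) 'C(n, j))
    = 2 ^ n + \sum_(j < n.+1 | P j && P (n - j)) 'C(n, j).
Proof.
move=> Pcompl.
have rev : \sum_(j < n.+1 | P j) 'C(n, j) = \sum_(j < n.+1 | P (n - j)) 'C(n, j).
  rewrite (reindex_inj rev_ord_inj) /=; apply: eq_big => j; first by rewrite subSS.
  by rewrite subSS bin_sub // -ltnS.
rewrite mul2n -addnn {2}rev -[2]/(1 + 1) expnDn.
under [in RHS]eq_bigr do rewrite !exp1n !muln1.
rewrite (big_mkcond (fun j : 'I__ => P j)) (big_mkcond (fun j : 'I__ => P (n - j))).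
rewrite (big_mkcond (fun j : 'I__ => P j && P (n - j))) -!big_split /=.
apply: eq_bigr => j _; have := Pcompl j; rewrite -ltnS ltn_ord => /(_ isT).
by case: (P j); case: (P (n - j)) => /=; lia.
Qed.

Theorem mainTheorem1 (k n : nat) (hk : 1 <= k) (hn : 2 * k < n) :
  (odd n ->
     m n <= 'C(n + k - 1, k) * m (n - 2 * k)
            + 'C(n + k - 1, k - 1) * 2 ^ (n - 1))
  /\
  (~~ odd n ->
     ((m n)%:R <= 'C(n + k - 1, k)%:R * (m (n - 2 * k))%:R
                  + 'C(n + k - 1, k - 1)%:R
                    * (2%:R ^+ (n - 1) + 1 / 2%:R * 'C(n, n %/ 2)%:R)
        :> rat)%R).
Proof.
have two_pow : 2 ^ n = 2 * 2 ^ (n - 1) by rewrite -expnS subn1 prednK //; lia.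
split=> [n_odd|n_even].
  (* For odd [n], exactly one of [j] and [n - j] is odd, so no term is counted twice. *)
  have Pcompl j : j <= n -> odd j || odd (n - j).
    by move=> le_jn; rewrite oddB // n_odd; case: (odd j).
  have := @m_le_of_pred k n odd hk hn (fun j => orbN (odd j)) Pcompl.
  rewrite (_ : \sum_(j < n.+1 | odd j) 'C(n, j) = 2 ^ (n - 1)) //.
  have := sum_bin_pred_double Pcompl; rewrite [in X in _ + X]big_pred0; first by lia.
  by move=> j /=; rewrite oddB -1?ltnS // n_odd; case: (odd j).
(* For even [n], [j] and [n - j] have equal parity, so the selected parity flips at the middle. Only
   the self-complementary size [n %/ 2] is counted twice. *)
pose P j := if j < n %/ 2 then odd j else (j == n %/ 2) || ~~ odd j.
have Psucc j : P j || P j.+1.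
  by rewrite /P; case: (ltnP j); case: (ltnP j.+1) => /=; lia.
have Pcompl j : j <= n -> P j || P (n - j)
  by rewrite /P => le_jn; case: (ltnP j); case: (ltnP (n - j)); lia.
have Pboth j : j <= n -> P j && P (n - j) = (j == n %/ 2).
  by rewrite /P => le_jn; apply/idP/idP; case: (ltnP j); case: (ltnP (n - j)); lia.
have Pboth_ord (j : 'I_n.+1) : P j && P (n - j) = (j == inord (n %/ 2)).
  by rewrite Pboth -1?ltnS // -val_eqE /= inordK // ltnS leq_div.
have sumE := sum_bin_pred_double Pcompl.
rewrite (eq_bigl _ _ Pboth_ord) big_pred1_eq inordK ?ltnS ?leq_div // two_pow in sumE.
have := @m_le_of_pred k n P hk hn Psucc Pcompl.
set s := \sum_(j < _ | _) _ in sumE *.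
rewrite -(ler_nat rat) natrD !natrM.
(* This is half of [sumE], read in [rat]. *)
suff -> : (s%:R = 2%:R ^+ (n - 1) + 1 / 2%:R * 'C(n, n %/ 2)%:R :> rat)%R by [].
have := congr1 (fun x => x%:R%R : rat) sumE.
rewrite /= natrD !natrM natrX.
lra.
Qed.
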